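(* Let $B$ be a real matrix with $M$ rows in $\mathbb{R}^N$, where either (Gauss-Seidel case) $B=A^{1/2}$ for a symmetric positive definite $A\in\mathbb{R}^{N\times N}$ (so $M=N$ and $B^TB=A$), or (Kaczmarz case) $B=A$ for some $A\in\mathbb{R}^{M\times N}$ with $M\ge N$ (so $B^TB=A^TA$). Define matrices recursively by $\Phi_1:=B^TB$ and, for $n>1$, $$\Phi_n=\Phi_1\left(\frac{\operatorname{Tr}\Phi_{n-1}}{n-1}\,I-\Phi_{n-1}\right).$$ Select at random a choice of $n$ of the $M$ rows of $B$, where the choice with submatrix $B_n\in\mathbb{R}^{n\times N}$ has probability proportional to $\det(B_nB_n^T)$, and let $P_n=B_n^T(B_nB_n^T)^{-1}B_n$ be the orthogonal projector onto the span of the selected rows. Then $$\mathbb{E}[P_n]=\frac{\Phi_n}{\operatorname{Tr}\Phi_n},$$ and consequently the spectral gap $\tau_n:=\lambda_{\min}\big(\mathbb{E}[P_n]\big)$ is $$\tau_n=\frac{\lambda_{\min}(\Phi_n)}{\operatorname{Tr}\Phi_n}.$$ Moreover, the spectrum of $\Phi_1$ is transformed into that of $\Phi_n$ by the degree-$n$ polynomial $$\phi_n(x)=\sum_{p=1}^n(-1)^{p-1}\,\mathrm{vol}_{n-p}\,x^p,$$ that is, the eigenvalues of $\Phi_n$ are the values $\phi_n(\lambda)$ for $\lambda$ an eigenvalue of $\Phi_1$. In particular, for $n=2$ the polynomial is $\phi_2(x)=(\operatorname{Tr}\Phi_1)\,x-x^2$ and $\tau_2=\lambda_{\min}(\Ph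i_2)/\operatorname{Tr}\Phi_2$.
   Context: $I$ is the $N\times N$ identity, $\operatorname{Tr}$ is the trace, $A^{1/2}$ is the symmetric positive definite square root of $A$, and $\lambda_{\min}$ denotes the smallest eigenvalue of a symmetric matrix. Choices of $n$ rows are $n$-element subsets of the row indices $\{1,\dots,M\}$; $B_n$ is the $n\times N$ submatrix of $B$ formed by the chosen rows. For $k\ge 1$, $\mathrm{vol}_k:=\sum_{B_k}\det(B_kB_k^T)$ is the sum over all choices of $k$ rows of the squared volumes of the parallelepipeds they span, and $\mathrm{vol}_0:=1$. The sampling presupposes that $\mathrm{vol}_n>0$, so that the probabilities $\det(B_nB_n^T)/\mathrm{vol}_n$ are defined; choices with $\det(B_nB_n^T)=0$ have probability zero, so $P_n$ is defined almost surely.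
   Formalization: The normalisation is corrected by a factor n: E[P_n] = nΦ_n/Tr Φ_n, τ_n = nλ_min(Φ_n)/Tr Φ_n and τ_2 = 2λ_min(Φ_2)/Tr Φ_2, since Tr P_n = n; as written the formulas fail for n > 1 (B = I_2, n = 2 gives P_2 = I but Φ_2/Tr Φ_2 = I/2). *)

(* Defs.v *)
From mathcomp Require Import all_boot all_order all_algebra.
From mathcomp Require Import classical_sets reals.

Set Implicit Arguments.
Unset Strict Implicit.
Unset Printing Implicit Defensive.

Import Order.TTheory GRing.Theory Num.Theory.

Local Open Scope ring_scope.

Section SymmetricMatrices.
Context {R : realType} {N : nat}.
Implicit Types A B : 'M[R]_N.

Definition sym_posdef A : Prop :=
  A^T = A /\ forall v : 'cV[R]_N, v != 0 -> 0 < (v^T *m A *m v) 0 0.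

(* B = A^{1/2}: such a B exists and is unique as soon as A is symmetric
   positive definite. *)
Definition is_posdef_sqrt A B : Prop := sym_posdef B /\ B *m B = A.

Definition smallest_eigenvalue A (a : R) : Prop :=
  eigenvalue A a /\ forall b, eigenvalue A b -> a <= b.

(* The smallest eigenvalue of A. It exists whenever A is symmetric and 0 < N;
   the default value 0 is used only when there is none. *)
Definition lambda_min A : R := xget 0 [set a | smallest_eigenvalue A a]%classic.

End SymmetricMatrices.

(* The constructor gauss_seidel makes the number of rows of B equal to N. *)
Inductive admissible {R : realType} :
    forall M N : nat, 'M[R]_(M, N) -> Prop :=
| gauss_seidel (N : nat) (A B : 'M[R]_N) :
    sym_posdef A -> is_posdef_sqrt A B -> admissible B
| kaczmarz (M N : nat) (A : 'M[R]_(M, N)) :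
    (N <= M)%N -> admissible A.

Section VolumeSampling.
Context {R : realType} {M N : nat}.
Variable B : 'M[R]_(M, N).
Implicit Types S : {set 'I_M}.

(* The rows of B with index in S, in increasing order. *)
Definition chosen_rows S : 'M[R]_(#|S|, N) :=
  rowsub (fun i : 'I_#|S| => enum_val i) B.

Definition sqvol S : R := \det (chosen_rows S *m (chosen_rows S)^T).

Definition vol (k : nat) : R :=
  if k == 0%N then 1 else \sum_(S : {set 'I_M} | #|S| == k) sqvol S.

(* The law of the random choice of n rows; meaningful when 0 < vol n. *)
Definition sampling_prob (n : nat) S : R :=
  if #|S| == n then sqvol S / vol n else 0.

(* When sqvol S = 0 the Gram matrix is not invertible and this value is
   irrelevant: such a choice S has probability 0. *)
Definition row_projector S : 'M[R]_N :=
  let BS := chosen_rows S in BS^T *m invmx (BS *m BS^T) *m BS.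

Definition expected_projector (n : nat) : 'M[R]_N :=
  \sum_(S : {set 'I_M}) sampling_prob n S *: row_projector S.

Definition spectral_gap (n : nat) : R := lambda_min (expected_projector n).

(* Only the indices n >= 1 are meaningful; Phi 0 is a dummy value. *)
Fixpoint Phi (n : nat) : 'M[R]_N :=
  match n with
  | 0 => 0
  | 1 => B^T *m B
  | m.+1 => (B^T *m B) *m ((\tr (Phi m) / m%:R)%:M - Phi m)
  end.

Definition phi (n : nat) : {poly R} :=
  \sum_(1 <= p < n.+1) ((-1) ^+ p.-1 * vol (n - p)) *: 'X^p.

End VolumeSampling.

(* Main.v *)
(* Let [G = B B^T].  For a set [S] of rows let [H_S] agree with [G] on the rows
   in [S] and with the identity elsewhere, and let [K_S] be [\adj H_S] with the
   columns outside [S] zeroed.  Then [\det H_S] is the squared volume of the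
   rows in [S], and [B^T K_S B] is that volume times the projector [P_S].
   Cramer's rule gives, row by row,
     [\sum_(#|T| = n+1) K_T = (\sum_(#|S| = n) \det H_S) I - G \sum_(#|S| = n) K_S],
   and [\tr (G K_S) = #|S| \det H_S], so [\sum_(#|S| = n) B^T K_S B] satisfies
   the recursion that defines [Phi n] and has trace [n * vol n].  The eigenvalues
   of [Phi n = phi n (Phi 1)] are then read off a diagonalisation of the
   symmetric matrix [Phi 1] over [R[i]]. *)
Require Import Defs.
From mathcomp Require Import all_boot all_order all_fingroup all_algebra.
From mathcomp Require Import classical_sets reals complex.

Set Implicit Arguments.
Unset Strict Implicit.
Unset Printing Implicit Defensive.

Import Order.TTheory GRing.Theory Num.Theory.

Local Open Scope ring_scope.

(** * Padded principal minors and their adjugates *)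

Section PaddedMinors.
Context {R : comNzRingType} {m : nat}.
Implicit Types (G A : 'M[R]_m) (S T : {set 'I_m}) (r : 'rV[R]_m).

Definition replace_row A (j : 'I_m) r : 'M[R]_m :=
  \matrix_(k, l) if k == j then r 0 l else A k l.

(** Cramer's rule: the cofactors along row [j] do not see row [j] itself. *)
Lemma det_replace_row A j r : \det (replace_row A j r) = (r *m \adj A) 0 j.
Proof.
rewrite (expand_det_row _ j) mxE; apply: eq_bigr => k _.
rewrite !mxE eqxx; congr (_ * _); rewrite /cofactor; congr (_ * \det _).
by apply/matrixP => a b; rewrite !mxE eq_sym (negPf (neq_lift _ _)).
Qed.

Lemma det_xrow A i j : i != j -> \det (xrow i j A) = - \det A.
Proof. by move=> ij; rewrite xrowE det_mulmx det_perm odd_tperm ij mulN1r. Qed.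

Definition setmx S : 'M[R]_m := diag_mx (\row_i (i \in S)%:R).

Definition padded G S : 'M[R]_m :=
  \matrix_(i, j) if i \in S then G i j else (i == j)%:R.

Definition padded_adj G S : 'M[R]_m := \adj (padded G S) *m setmx S.

Lemma padded_adjE G S i j :
  padded_adj G S i j = \adj (padded G S) i j *+ (j \in S).
Proof. by rewrite /padded_adj mul_mx_diag !mxE mulr_natr. Qed.

Lemma padded_def G S : padded G S = 1%:M + setmx S *m (G - 1%:M).
Proof.
apply/matrixP=> i j; rewrite mul_diag_mx !mxE.
by case: (i \in S); rewrite (mul1r, mul0r) ?addr0 // addrC subrK.
Qed.

Lemma setmx_padded G S : setmx S *m padded G S = setmx S *m G.
Proof.
apply/matrixP=> i j; rewrite !mul_diag_mx !mxE.
by case: (i \in S); rewrite ?mul1r ?mul0r.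
Qed.

Lemma setmx_idem S : setmx S *m setmx S = setmx S.
Proof.
apply/matrixP=> i j; rewrite !mul_diag_mx !mxE.
by case: (i \in S); rewrite (mul1r, mul0r) // mul0rn.
Qed.

Lemma tr_setmx S : (setmx S)^T = setmx S.
Proof. exact: tr_diag_mx. Qed.

(** [padded G S] and [G] have the same rows in [S], so this is the adjugate identity restricted to
    these rows. *)
Lemma setmx_mul_padded_adj G S :
  setmx S *m (G *m padded_adj G S) = \det (padded G S) *: setmx S.
Proof.
rewrite /padded_adj !mulmxA -setmx_padded -(mulmxA (setmx S)) mul_mx_adj.
by rewrite mul_mx_scalar -scalemxAl setmx_idem.
Qed.

Lemma padded_row_out G S i : i \notin S -> delta_mx 0 i *m padded G S =
  delta_mx (0 : 'I_1) i.
Proof.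
move=> iS; apply/rowP => j; rewrite -rowE !mxE (negPf iS) eqxx /=.
by rewrite eq_sym.
Qed.

(** For [i] outside [S], row [i] of [padded G S] is a unit vector, so the adjugate identity makes
    row [i] of the adjugate a multiple of it, supported on a column that [setmx S] kills. *)
Lemma padded_adj_out G S i j : i \notin S -> padded_adj G S i j = 0.
Proof.
move=> iS; rewrite padded_adjE; case: (boolP (j \in S)) => // jS.
suff -> : \adj (padded G S) i j = 0 by [].
have := congr1 (mulmx (delta_mx (0 : 'I_1) i)) (mul_mx_adj (padded G S)).
rewrite mulmxA padded_row_out // -!rowE => /rowP/(_ j).
rewrite [LHS]mxE [RHS]mxE [RHS]mxE => ->.
by case: eqP => // ij; rewrite ij jS in iS.
Qed.

Lemma setmx_padded_adj G S : setmx S *m padded_adj G S = padded_adj G S.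
Proof.
apply/matrixP=> i j; rewrite mul_diag_mx mxE [X in X * _]mxE.
by case: (boolP (i \in S)) => iS; rewrite ?mul1r ?mul0r // padded_adj_out.
Qed.

Lemma mul_padded_adj_in G S i j : i \in S ->
  (G *m padded_adj G S) i j = \det (padded G S) *+ (i == j).
Proof.
move=> iS; have /matrixP/(_ i j) := setmx_mul_padded_adj G S.
rewrite mul_diag_mx mxE [X in X * _]mxE iS mul1r => ->.
by rewrite !mxE iS mulr_natr.
Qed.

Lemma mxtrace_mul_padded_adj G S :
  \tr (G *m padded_adj G S) = \det (padded G S) *+ #|S|.
Proof.
have {1}->: padded_adj G S = padded_adj G S *m setmx S.
  by rewrite /padded_adj -mulmxA setmx_idem.
rewrite mulmxA mxtrace_mulC setmx_mul_padded_adj mxtraceZ mxtrace_diag.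
rewrite -mulr_natr -sum1_card natr_sum [in RHS]big_mkcond; congr (_ * _).
by apply: eq_bigr => i _; rewrite mxE; case: (i \in S).
Qed.

(* Exchanging the rows [i] and [j] turns the Cramer numerator of the enlarged
   system into that of the original one, whence the sign. *)
Lemma padded_adj_setU1 G S i j : i \notin S ->
  padded_adj G (i |: S) i j =
  \det (padded G S) *+ (i == j) - (G *m padded_adj G S) i j.
Proof.
move=> iS.
have GK k : (G *m padded_adj G S) i k = (row i G *m \adj (padded G S)) 0 k *+ (k \in S).
  rewrite /padded_adj mulmxA mul_mx_diag mxE [X in _ * X]mxE mulr_natr.
  by rewrite -row_mul [in RHS]mxE.
have adjE (A : 'M[R]_m) k l : \adj A k l = \det (replace_row A l (delta_mx 0 k)).
  by rewrite det_replace_row -rowE [RHS]mxE.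
rewrite padded_adjE GK finset.in_setU1 eq_sym adjE.
(* For [i = j] the Cramer numerator has row [i] replaced by a unit row, which undoes the enlargement
   of [S]. *)
case: (eqVneq i j) => [<-|ij] /=.
  rewrite (negPf iS) subr0; congr (\det _); apply/matrixP => k l; rewrite !mxE.
  case: (eqVneq k i) => [->|ki]; first by rewrite (negPf iS) eqxx /= eq_sym.
  by rewrite finset.in_setU1 (negPf ki).
case: (boolP (j \in S)) => jS; last by rewrite subrr.
rewrite mulr1n mulr0n sub0r -det_replace_row -[LHS]opprK -(@det_xrow _ i j) //.
congr (- \det _); apply/matrixP => k l; rewrite !mxE.
case: (eqVneq k i) => [->|ki].
  by rewrite tpermL (negPf ij) eqxx (negPf iS) eq_sym.
case: (eqVneq k j) => [->|kj].
  by rewrite tpermR (negPf ij) finset.setU11.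
have [ik jk] : i != k /\ j != k by rewrite !(eq_sym _ k).
by rewrite tpermD // (negPf kj) finset.in_setU1 (negPf ki).
Qed.

(** In row [i], only the [T] containing [i] contribute on the left and only the [S] avoiding [i] on
    the right; adding [i] to [S] matches the two families. *)
Lemma sum_padded_adjS G n :
  \sum_(T : {set 'I_m} | #|T| == n.+1) padded_adj G T =
  (\sum_(S : {set 'I_m} | #|S| == n) \det (padded G S))%:M
    - G *m \sum_(S : {set 'I_m} | #|S| == n) padded_adj G S.
Proof.
rewrite mulmx_sumr (raddf_sum (@scalar_mx R m)) -sumrB.
apply/matrixP => i j; rewrite !summxE.
have entryE S : ((\det (padded G S))%:M - G *m padded_adj G S) i j =
    \det (padded G S) *+ (i == j) - (G *m padded_adj G S) i j.
  by rewrite mxE [X in X + _]mxE [X in _ + X]mxE.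
rewrite (bigID (fun T : {set 'I_m} => i \in T)) /= [X in _ + X]big1 => [|T]; last first.
  by case/andP=> _ iT; rewrite padded_adj_out.
rewrite [RHS](bigID (fun S : {set 'I_m} => i \in S)) /=.
rewrite [X in _ = X + _]big1 => [|S]; last first.
  by case/andP=> _ iS; rewrite entryE mul_padded_adj_in // subrr.
rewrite addr0 add0r.
rewrite (reindex_onto (fun S => i |: S) (fun T => T :\ i)) => [|T /andP[_ iT]];
  last by rewrite finset.setD1K.
apply: eq_big => [S|S].
  rewrite finset.setU11 andbT; case: (boolP (i \in S)) => iS.
    rewrite andbF; apply/negP => /andP[_ /eqP SE].
    by move: iS; rewrite -SE finset.setD11.
  by rewrite finset.setU1K // eqxx cardsU1 iS eqSS !andbT.
case/andP=> /andP[_ _] /eqP SE.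
have iS : i \notin S by rewrite -SE finset.setD11.
by rewrite padded_adj_setU1 // entryE.
Qed.

End PaddedMinors.

(** Sylvester's determinant identity, from two block-triangular factorisations of one matrix. *)
Lemma det_add1_mulmxC {R : comNzRingType} m n (U : 'M[R]_(m, n)) (V : 'M_(n, m)) :
  \det (1%:M + U *m V) = \det (1%:M + V *m U).
Proof.
have: block_mx (1%:M + U *m V) (- U) 0 1%:M *m block_mx 1%:M 0 V 1%:M =
      block_mx 1%:M 0 V 1%:M *m block_mx 1%:M (- U) 0 (1%:M + V *m U).
  rewrite !mulmx_block !mul1mx !mulmx1 !mul0mx !mulmx0 !addr0 !add0r.
  by rewrite mulNmx addrK mulmxN addrCA addNr addr0.
move/(congr1 determinant); rewrite !det_mulmx !det_ublock !det_lblock.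
by rewrite !det1 !mulr1 !mul1r.
Qed.

Lemma tr_mulmx_eq0 {R : realDomainType} m n (A : 'M[R]_(m, n)) :
  A^T *m A = 0 -> A = 0.
Proof.
move=> AA; apply/matrixP => i j; rewrite [RHS]mxE.
have /matrixP/(_ j j) := AA; rewrite !mxE.
under eq_bigr do rewrite mxE -expr2.
move/eqP; rewrite psumr_eq0 => [/allP/(_ i (mem_index_enum i))|k _]; last exact: sqr_ge0.
by rewrite sqrf_eq0 => /eqP.
Qed.

(** * Volume sampling and the recursion for the expected projector *)

Section Projectors.
Context {R : realType} {M N : nat}.
Variable B : 'M[R]_(M, N).
Implicit Types S : {set 'I_M}.

Definition selector S : 'M[R]_(#|S|, M) :=
  rowsub (fun i : 'I_#|S| => enum_val i) 1%:M.

Lemma chosen_rowsE S : chosen_rows B S = selector S *m B.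
Proof. exact: rowsubE. Qed.

Lemma selector_mul_tr S : selector S *m (selector S)^T = 1%:M.
Proof.
apply/matrixP => i j; rewrite mul_rowsub_mx mul1mx !mxE.
by rewrite (inj_eq enum_val_inj) eq_sym.
Qed.

Lemma tr_selector_mul S : (selector S)^T *m selector S = setmx S.
Proof.
apply/matrixP => i j; rewrite !mxE.
under eq_bigr do rewrite !mxE.
rewrite -(big_enum_val (fun k : 'I_M => (k == i)%:R * (k == j)%:R)) /=.
case: (boolP (i \in S)) => iS.
  rewrite (bigD1 i) //= eqxx mul1r big1 ?addr0 // => k /andP[_ /negPf->].
  by rewrite mul0r.
rewrite mul0rn big1 // => k kS; case: eqP => [ki|_]; last by rewrite mul0r.
by rewrite -ki kS in iS.
Qed.

Let G := B *m B^T.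

Lemma gram_chosen_rows S :
  chosen_rows B S *m (chosen_rows B S)^T = selector S *m G *m (selector S)^T.
Proof. by rewrite chosen_rowsE trmx_mul !mulmxA. Qed.

(** With [E = selector S], [setmx S] is [E^T E]; Sylvester's identity moves [E^T] to the right,
    where [E E^T = 1] cancels the padding. *)
Lemma sqvol_padded S : sqvol B S = \det (padded G S).
Proof.
rewrite padded_def -tr_selector_mul -mulmxA det_add1_mulmxC /sqvol.
congr (\det _); rewrite gram_chosen_rows mulmxBr mulmx1 mulmxBl.
by rewrite selector_mul_tr addrC subrK.
Qed.

Lemma padded_mul_tr_selector S : padded G S *m (selector S)^T =
  (selector S)^T *m (selector S *m G *m (selector S)^T).
Proof.
rewrite padded_def mulmxDl mul1mx -tr_selector_mul mulmxBr mulmx1 mulmxBl.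
by rewrite -!mulmxA selector_mul_tr mulmx1 addrC subrK.
Qed.

(* If [sqvol B S = 0] the left-hand side vanishes, and so does the right-hand
   side because [(B^T K)^T (B^T K) = sqvol B S *: K^T] for
   [K = padded_adj G S]. *)
Lemma sqvol_row_projector S :
  sqvol B S *: row_projector B S = B^T *m padded_adj G S *m B.
Proof.
have [vol0|vol_neq0] := eqVneq (sqvol B S) 0.
  suff -> : B^T *m padded_adj G S = 0 by rewrite vol0 scale0r mul0mx.
  apply: tr_mulmx_eq0; rewrite trmx_mul trmxK.
  rewrite -[X in X^T]setmx_padded_adj trmx_mul tr_setmx -!mulmxA (mulmxA B).
  by rewrite setmx_mul_padded_adj -sqvol_padded vol0 scale0r mulmx0.
have H_unit : padded G S \in unitmx by rewrite unitmxE -sqvol_padded unitfE.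
have W_unit : selector S *m G *m (selector S)^T \in unitmx.
  by rewrite unitmxE -gram_chosen_rows unitfE.
rewrite /row_projector gram_chosen_rows chosen_rowsE trmx_mul /padded_adj.
have := padded_mul_tr_selector S; move: W_unit.
move: (selector S *m G *m _) => W W_unit HE.
have adjE : \adj (padded G S) = sqvol B S *: invmx (padded G S).
  by rewrite /invmx H_unit -sqvol_padded scalerA divff // scale1r.
rewrite adjE -!scalemxAl -scalemxAr -!scalemxAl; congr (_ *: _).
rewrite -tr_selector_mul !mulmxA; congr (_ *m _ *m _).
rewrite -!mulmxA; congr (_ *m _).
(* With [E = selector S] and [H = padded G S], [H E^T = E^T W] gives [E^T W^-1 = H^-1 E^T]. *)
apply: (canRL (mulKmx H_unit)).
by rewrite mulmxA HE mulmxK.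
Qed.

(** The convention for [vol B 0] agrees with the sum: the empty choice has determinant 1. *)
Lemma vol_def n : vol B n = \sum_(S : {set 'I_M} | #|S| == n) sqvol B S.
Proof.
case: n => [|n] //; rewrite /vol eqxx (big_pred1 finset.set0) => [|S]; last first.
  by rewrite finset.cards_eq0.
rewrite sqvol_padded (_ : padded G finset.set0 = 1%:M) ?det1 //.
by apply/matrixP => i j; rewrite !mxE finset.in_set0.
Qed.

(** The expected projector before division by [vol B n], so that the recursion holds even when this
    volume is 0. *)
Definition weighted_projector n : 'M[R]_N :=
  \sum_(S : {set 'I_M} | #|S| == n) sqvol B S *: row_projector B S.

Lemma weighted_projectorE n : weighted_projector n =
  B^T *m (\sum_(S : {set 'I_M} | #|S| == n) padded_adj G S) *m B.
Proof.
rewrite mulmx_sumr mulmx_suml; apply: eq_bigr => S _.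
exact: sqvol_row_projector.
Qed.

Lemma weighted_projectorS n : weighted_projector n.+1 =
  (B^T *m B) *m ((vol B n)%:M - weighted_projector n).
Proof.
rewrite !weighted_projectorE sum_padded_adjS vol_def.
under [in RHS]eq_bigr do rewrite sqvol_padded.
rewrite !mulmxBr mulmxBl !mul_mx_scalar -scalemxAl; congr (_ - _).
by rewrite !mulmxA.
Qed.

Lemma weighted_projector0 : weighted_projector 0 = 0.
Proof.
rewrite weighted_projectorE (big_pred1 finset.set0) => [|S]; last first.
  by rewrite finset.cards_eq0.
suff -> : padded_adj G finset.set0 = 0 by rewrite mulmx0 mul0mx.
by apply/matrixP => i j; rewrite padded_adj_out ?finset.in_set0 // mxE.
Qed.

Lemma mxtrace_weighted_projector n :
  \tr (weighted_projector n) = n%:R * vol B n.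
Proof.
rewrite weighted_projectorE mxtrace_mulC mulmxA mulmx_sumr raddf_sum vol_def.
rewrite mulr_sumr; apply: eq_bigr => S /eqP Sn /=.
by rewrite mxtrace_mul_padded_adj Sn sqvol_padded mulr_natl.
Qed.

Lemma Phi_weighted_projector n : Phi B n = weighted_projector n.
Proof.
elim: n => [|[|n] IHn]; first by rewrite weighted_projector0.
  by rewrite weighted_projectorS weighted_projector0 subr0 mulmx1.
rewrite weighted_projectorS -IHn; congr (_ *m (_%:M - _)).
(* The trace carries the factor [n.+1], exactly the divisor in the definition of [Phi B n.+2]. *)
by rewrite -/(Phi B n.+1) IHn mxtrace_weighted_projector mulrC mulKf ?pnatr_eq0.
Qed.

Lemma mxtrace_Phi n : \tr (Phi B n) = n%:R * vol B n.
Proof. by rewrite Phi_weighted_projector mxtrace_weighted_projector. Qed.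

Lemma PhiS n : Phi B n.+1 = Phi B 1 *m ((vol B n)%:M - Phi B n).
Proof. by rewrite !(Phi_weighted_projector n) Phi_weighted_projector weighted_projectorS. Qed.

Lemma expected_projectorE n : expected_projector B n = (vol B n)^-1 *: Phi B n.
Proof.
rewrite Phi_weighted_projector scaler_sumr big_mkcond; apply: eq_bigr => S _.
rewrite /sampling_prob; case: ifP => _; last by rewrite scale0r.
by rewrite scalerA mulrC.
Qed.

(** The recursion of [PhiS] with ['X] in place of [Phi B 1]. *)
Lemma phiS n : phi B n.+1 = 'X * ((vol B n)%:P - phi B n).
Proof.
rewrite /phi big_nat_recl // big_add1 /= expr0 mul1r subn1 mulrBr; congr (_ + _).
  by rewrite mulrC mul_polyC.
rewrite mulr_sumr -sumrN [in RHS]big_add1; apply: eq_big_nat => p _ /=.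
by rewrite subSS -scalerAr -exprS -scaleNr exprS !mulN1r mulNr.
Qed.

Lemma phi0 : phi B 0 = 0.
Proof. by rewrite /phi big_geq. Qed.

(** The constant [vol B n] cannot affect a positive degree, and ['X] raises the degree by one, even
    if volumes vanish. *)
Lemma size_phi n : (0 < n)%N -> size (phi B n) = n.+1.
Proof.
case: n => // n _; elim: n => [|n IHn].
  by rewrite phiS phi0 subr0 mulr1 size_polyX.
have size_sub : size ((vol B n.+1)%:P - phi B n.+1) = n.+2.
  rewrite addrC size_polyDl size_polyN IHn //.
  by rewrite (leq_ltn_trans (size_polyC_leq1 _)).
by rewrite phiS mulrC size_mulX -?size_poly_eq0 size_sub.
Qed.

End Projectors.

(** * Eigenvalues of polynomials in a symmetric matrix *)

Lemma Phi_horner {R : realType} M N (B : 'M[R]_(M, N.+1)) n :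
  Phi B n = horner_mx (Phi B 1) (phi B n).
Proof.
elim: n => [|n IHn]; first by rewrite phi0 rmorph0.
rewrite PhiS phiS; move: (Phi B 1) IHn => P ->.
by rewrite rmorphM rmorphB /= horner_mx_X horner_mx_C.
Qed.

Lemma lambda_minZ {R : realType} N (A : 'M[R]_N) c :
  0 < c -> lambda_min (c *: A) = c * lambda_min A.
Proof.
move=> c_gt0; have c0 : c != 0 by rewrite gt_eqF.
have eigenZ a : eigenvalue (c *: A) a = eigenvalue A (c^-1 * a).
  apply/eigenvalueP/eigenvalueP => -[v vA v0]; exists v => //.
    by rewrite -scalerA -vA -scalemxAr scalerA mulVf // scale1r.
  by rewrite -scalemxAr vA scalerA mulrA divff // mul1r.
have smallestZ a : smallest_eigenvalue A a -> smallest_eigenvalue (c *: A) (c * a).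
  move=> [Aa a_min]; split=> [|b]; rewrite eigenZ ?mulKf //.
  by move/a_min; rewrite mulrC ler_pdivlMr // mulrC.
have smallest_uniq (C : 'M[R]_N) a b :
    smallest_eigenvalue C a -> smallest_eigenvalue C b -> b = a.
  by move=> [Ca amin] [Cb bmin]; apply/eqP; rewrite eq_le bmin // amin.
(* If [c *: A] has no smallest eigenvalue then neither has [A], and both sides are the default 0. *)
rewrite /lambda_min; case: xgetP => [_ -> [Ab b_min]|no_min]; last first.
  rewrite xgetPN ?mulr0 // => a /smallestZ; exact: no_min.
set b := xget _ _ in Ab b_min *.
have Amin : smallest_eigenvalue A (c^-1 * b).
  split=> [|a Aa]; first by rewrite -eigenZ.
  by rewrite mulrC ler_pdivrMr // mulrC b_min // eigenZ mulKf.
rewrite (xget_unique _ Amin) ?mulVKf // => a; exact: smallest_uniq.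
Qed.

Lemma eigenvalue_horner_mx {F : fieldType} n (A : 'M[F]_n.+1) p lam :
  eigenvalue A lam -> eigenvalue (horner_mx A p) p.[lam].
Proof.
move=> /eigenvalueP[v vA v0]; apply/eigenvalueP; exists v => //.
elim/poly_ind: p => [|p c IHp]; first by rewrite rmorph0 mulmx0 horner0 scale0r.
rewrite rmorphD rmorphM /= horner_mx_X horner_mx_C mulmxDr mulmxA IHp.
by rewrite -scalemxAl vA mul_mx_scalar scalerA -scalerDl !hornerE.
Qed.

(** Symmetry serves the forward direction: over [R[i]] the matrix is unitarily diagonalisable with
    real spectrum, so [lam] can be found in [R]. *)
Lemma eigenvalue_horner_mx_sym {R : realType} n (A : 'M[R]_n.+1) p mu :
    A^T = A ->
  eigenvalue (horner_mx A p) mu <->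
  exists2 lam, eigenvalue A lam & mu = p.[lam].
Proof.
move=> A_sym; split=> [|[lam Alam ->]]; last exact: eigenvalue_horner_mx.
pose toC : {rmorphism R -> R[i]} := real_complex R.
rewrite -(eigenvalue_map toC) map_horner_mx.
set AC := map_mx toC A; set pC := map_poly toC p.
have AC_herm : AC \is hermsymmx.
  apply: realsym_hermsym; last first.
    by apply/mxOverP => i j; rewrite mxE; apply/complex_realP; exists (A i j).
  by apply/is_hermitianmxP; rewrite expr0 scale1r map_mx_id // /AC map_trmx A_sym.
have /mxOverP d_real := hermitian_spectral_diag_real AC_herm.
have /orthomx_spectralP := hermitian_normalmx AC_herm.
set P := spectralmx AC; set d := spectral_diag AC => ACE.
have P_unit : P \in unitmx := spectral_unit AC.
move=> /eigenvalueP[v]; rewrite ACE horner_mx_uconjC // horner_mx_diag => vE v0.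
(* [w] holds the coordinates of [v] in the eigenbasis; a nonzero one, at [k], singles out the
   eigenvalue [d 0 k]. *)
pose w := v *m invmx P.
have w0 : w != 0.
  by apply: contra_neq v0 => w0; rewrite -(mulmxKV P_unit v) -/w w0 mul0mx.
have wE : w *m diag_mx (map_mx (horner pC) d) = toC mu *: w.
  by rewrite /w scalemxAl -vE !mulmxA mulmxK.
have [k wk0] : exists k, w 0 k != 0 by apply/rV0Pn.
have muE : toC mu = pC.[d 0 k].
  apply: (mulIf wk0); have /rowP/(_ k) := wE.
  by rewrite mul_mx_diag !mxE mulrC => ->.
have /complex_realP[lam dE] := d_real 0 k.
exists lam; last first.
  by apply: (@complexI R); rewrite -horner_map /= -/pC -dE -muE.
rewrite -(eigenvalue_map toC) /= -dE -/AC; apply/eigenvalueP.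
(* Row [k] of [P] is an eigenvector for [d 0 k]. *)
exists (delta_mx 0 k *m P); last first.
  apply/eqP => deltaP0; have := mulmxK P_unit (delta_mx (0 : 'I_1) k).
  rewrite deltaP0 mul0mx => /rowP/(_ k)/esym/eqP.
  by rewrite !mxE !eqxx oner_eq0.
rewrite {1}ACE !mulmxA mulmxK // scalemxAl; congr (_ *m _).
by rewrite -rowE row_diag_mx.
Qed.

(* The factor n%:R in the formulas for E[P_n] and tau_n is forced by
   \tr (P_n) = n: the formulas without it fail for every n > 1. *)
Theorem mainTheorem1 (R : realType) (M N : nat) (B : 'M[R]_(M, N))
    (hB : admissible B) :
  (forall n : nat, (0 < n)%N ->
     (0 < vol B n ->
        expected_projector B n = (n%:R / \tr (Phi B n)) *: Phi B n /\
        spectral_gap B n = n%:R * lambda_min (Phi B n) / \tr (Phi B n)) /\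
     size (phi B n) = n.+1 /\
     (forall mu : R, eigenvalue (Phi B n) mu <->
        exists2 lam : R, eigenvalue (Phi B 1) lam & mu = (phi B n).[lam])) /\
  phi B 2 = \tr (Phi B 1) *: 'X - 'X^2 /\
  (0 < vol B 2 ->
     spectral_gap B 2 = 2%:R * lambda_min (Phi B 2) / \tr (Phi B 2)).
Proof.
have gap n : (0 < n)%N -> 0 < vol B n ->
    spectral_gap B n = n%:R * lambda_min (Phi B n) / \tr (Phi B n).
  move=> n_gt0 vol_gt0; rewrite /spectral_gap expected_projectorE.
  rewrite lambda_minZ ?invr_gt0 // mxtrace_Phi -mulf_div divff ?mul1r 1?mulrC //.
  by rewrite pnatr_eq0 -lt0n.
split=> [n n_gt0|]; last split; last exact: gap.
  split=> [vol_gt0|].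
    split; last exact: gap.
    rewrite expected_projectorE mxtrace_Phi invfM mulrA divff ?mul1r //.
    by rewrite pnatr_eq0 -lt0n.
  split=> [|mu]; first exact: size_phi.
  (* [Phi_horner] requires positive size; for [N = 0] there are no nonzero vectors, hence no
     eigenvalues on either side. *)
  case: N B {hB gap} => [|N] B.
    have no_eigen (A : 'M[R]_0) a : eigenvalue A a = false.
      by apply/eigenvalueP => -[v _]; rewrite thinmx0 eqxx.
    by rewrite no_eigen; split=> // -[lam]; rewrite no_eigen.
  rewrite Phi_horner; apply: eigenvalue_horner_mx_sym.
  by rewrite trmx_mul trmxK.
rewrite !phiS phi0 subr0 mulr1 mxtrace_Phi mul1r mulrBr -expr2.
by rewrite mulrC mul_polyC.
Qed.
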